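(* Let $\mathfrak{A}$ be a fusion ring with basis $\{x_1=1,x_2,\dots,x_m\}$ and fusion coefficients $x_jx_k=\sum_{\ell=1}^mN_{j,k}^\ell x_\ell$. Then for all indices in $\{1,\dots,m\}$: (1) $\sum_{\ell=1}^m\left(N_{j,k}^\ell\right)^2\le\min\{d(x_j)^2,d(x_k)^2\}$; (2) $N_{j,k}^\ell\le d(x_\ell)\,d(x_j)^{\frac{2-t}{t}}d(x_k)^{\frac{t-2}{t}}$ for any $t\ge1$; (3) $N_{j,k}^\ell\le\min\{d(x_j),d(x_k),d(x_\ell)\}$; (4) $\sum_{s=1}^mN_{j_1,j_2}^sN_{j_3,j_4}^s\le\min_{1\le a<b\le4}d(x_{j_a})\,d(x_{j_b})$.
   Context: A fusion ring is a ring with unit $x_1=1$, free as a $\mathbb{Z}$-module on a finite basis $\{x_1,\dots,x_m\}$, with $x_jx_k=\sum_\ell N_{j,k}^\ell x_\ell$, $N_{j,k}^\ell\in\mathbb{Z}_{\ge0}$, together with an involution $*$ of $\{1,\dots,m\}$ such that $x_k\mapsto x_{k^*}$ extends to an anti-involution and $N_{j,k}^1=\delta_{j,k^*}$. $d(x_j)$ denotes the Frobenius-Perron dimension of $x_j$, i.e. the operator norm of the matrix $(N_{j,k}^s)_{k,s}$ of left multiplication by $x_j$. *)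

(* Defs.v *)
From mathcomp Require Import all_boot all_order all_algebra.
From mathcomp Require Import all_classical all_reals all_analysis.

Set Implicit Arguments.
Unset Strict Implicit.
Unset Printing Implicit Defensive.

Import Order.TTheory GRing.Theory Num.Theory.

Local Open Scope classical_set_scope.
Local Open Scope ring_scope.

(* The rank is m.+1, and the index ord0 is that of the basis element 1.
   The ring is not assumed commutative. *)
Record fusion_ring (A : pzRingType) (m : nat) := FusionRing {
  fbasis : 'I_m.+1 -> A;
  fbasis1 : fbasis ord0 = 1;
  fbasis_free : forall a : A,
    exists! c : {ffun 'I_m.+1 -> int}, a = \sum_i fbasis i *~ c i;
  (* fcoef j k l is the coefficient of fbasis l in fbasis j * fbasis k *)
  fcoef : 'I_m.+1 -> 'I_m.+1 -> 'I_m.+1 -> nat;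
  fbasisM : forall j k,
    fbasis j * fbasis k = \sum_l fbasis l *+ fcoef j k l;
  fdual : 'I_m.+1 -> 'I_m.+1;
  fdualK : involutive fdual;
  fstar : {additive A -> A};
  fstarK : involutive fstar;
  fstarM : forall a b, fstar (a * b) = fstar b * fstar a;
  fstar_basis : forall k, fstar (fbasis k) = fbasis (fdual k);
  fcoef_unit : forall j k, fcoef j k ord0 = (j == fdual k)
}.

Definition norm2 (R : realType) (n : nat) (v : 'cV[R]_n) : R :=
  Num.sqrt (\sum_i v i ord0 ^+ 2).

Definition opnorm (R : realType) (n : nat) (M : 'M[R]_n) : R :=
  sup [set norm2 (M *m v) | v in [set v : 'cV[R]_n | norm2 v <= 1]].

Definition fmx (R : realType) (A : pzRingType) (m : nat)
    (F : fusion_ring A m) (j : 'I_m.+1) : 'M[R]_m.+1 :=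
  \matrix_(k, s) (fcoef F j k s)%:R.

Definition fpdim (R : realType) (A : pzRingType) (m : nat)
    (F : fusion_ring A m) (j : 'I_m.+1) : R :=
  opnorm (fmx R F j).

(* Main.v *)
(** Let M_j be the matrix of left multiplication by x_j. Frobenius reciprocity
    (invariance of the coefficient of 1 in x_j x_k x_l under cyclic rotation)
    makes M_{j^*} the transpose of M_j, so d(x_{j^*}) = d(x_j), and gives
    N_{j,k}^l = N_{l,k^*}^j = N_{j^*,l}^k. The numbers N_{j,k}^l, l = 1..m, form
    a column of M_{j^*}, which yields (1) and hence (3). For (4), apply
    Cauchy-Schwarz to the sum and to its rotated form
    sum_s N_{j2,j4^*}^s N_{j1^*,j3}^s. For (2), monotonicity of the operator
    norm on nonnegative matrices gives N_{j,k}^l d(x_l) <= d(x_j) d(x_k); by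
    reciprocity N_{j,k}^l <= d(x_l) min(r, 1/r) with r = d(x_j)/d(x_k), and
    min(r, 1/r) <= r^theta for theta = (2-t)/t in [-1, 1]. *)
Require Import Defs.
From mathcomp Require Import all_boot all_order all_algebra.
From mathcomp Require Import all_classical all_reals all_analysis.
From mathcomp Require Import ring lra.

Import Order.TTheory GRing.Theory Num.Theory.
Local Open Scope ring_scope.

(** * Euclidean norm and the Cauchy-Schwarz inequality *)

Lemma sum_sqr_ge0 {R : realType} {I : finType} (f : I -> R) :
  0 <= \sum_i f i ^+ 2.
Proof. by apply: sumr_ge0 => i _; exact: sqr_ge0. Qed.

Lemma cauchy_schwarz_sum {R : realType} {I : finType} (f g : I -> R) :
  (\sum_i f i * g i) ^+ 2 <= (\sum_i f i ^+ 2) * (\sum_i g i ^+ 2).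
Proof.
set a : R := \sum_i f i ^+ 2; set b : R := \sum_i g i ^+ 2.
set c : R := \sum_i f i * g i.
have b0 : 0 <= b := sum_sqr_ge0 g.
have [bE|b_neq0] := eqVneq b 0.
  have g0 i : g i = 0.
    have /(_ i isT)/eqP := psumr_eq0P (fun i _ => sqr_ge0 (g i)) bE.
    by rewrite sqrf_eq0 => /eqP.
  have -> : c = 0 by apply: big1 => i _; rewrite g0 mulr0.
  by rewrite bE mulr0 expr0n.
have b_gt0 : 0 < b by rewrite lt_neqAle eq_sym b_neq0.
(* This sum of squares equals [b * (a * b - c ^+ 2)]; dividing by [b > 0] gives the claim. *)
have := sum_sqr_ge0 (fun i => b * f i - c * g i).
have -> : \sum_i (b * f i - c * g i) ^+ 2 = b * (a * b - c ^+ 2).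
  transitivity (b ^+ 2 * a - 2 * b * c * c + c ^+ 2 * b); last by ring.
  rewrite [b ^+ 2 * a]mulr_sumr [_ * c * c]mulr_sumr [c ^+ 2 * b]mulr_sumr.
  rewrite -sumrB -big_split /=.
  by apply: eq_bigr => i _; ring.
by rewrite pmulr_rge0// subr_ge0.
Qed.

Lemma norm2_ge0 {R : realType} {n : nat} (v : 'cV[R]_n) : 0 <= norm2 v.
Proof. exact: sqrtr_ge0. Qed.

Lemma sqr_norm2 {R : realType} {n : nat} (v : 'cV[R]_n) :
  norm2 v ^+ 2 = \sum_i v i ord0 ^+ 2.
Proof. by rewrite sqr_sqrtr// sum_sqr_ge0. Qed.

Lemma norm2Z {R : realType} {n : nat} (a : R) (v : 'cV[R]_n) :
  norm2 (a *: v) = `|a| * norm2 v.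
Proof.
rewrite /norm2 -sqrtr_sqr -sqrtrM ?sqr_ge0// mulr_sumr; congr Num.sqrt.
by apply: eq_bigr => i _; rewrite mxE exprMn.
Qed.

Lemma norm2_delta {R : realType} {n : nat} (k : 'I_n) :
  norm2 (delta_mx k ord0 : 'cV[R]_n) = 1.
Proof.
rewrite /norm2 (bigD1 k)//= big1 ?addr0 => [|i /negPf ik].
  by rewrite mxE !eqxx expr1n sqrtr1.
by rewrite mxE ik expr0n.
Qed.

Lemma norm2_le {R : realType} {n : nat} (u v : 'cV[R]_n) :
  (forall i, `|u i ord0| <= v i ord0) -> norm2 u <= norm2 v.
Proof.
move=> uv; rewrite ler_sqrt ?sum_sqr_ge0//; apply: ler_sum => i _.
rewrite -(real_normK (num_real (u i ord0))) lerXn2r ?nnegrE//.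
by rewrite (le_trans _ (uv i)).
Qed.

Lemma dot_le_norm2 {R : realType} {n : nat} (u v : 'cV[R]_n) :
  (u^T *m v) ord0 ord0 <= norm2 u * norm2 v.
Proof.
apply: le_trans (ler_norm _) _.
rewrite -[leLHS]sqrtr_sqr -sqrtrM ?sum_sqr_ge0// ler_sqrt; last first.
  by rewrite mulr_ge0 ?sum_sqr_ge0.
rewrite mxE; under eq_bigr do rewrite mxE.
exact: cauchy_schwarz_sum.
Qed.

(** * Operator norm of real matrices *)

Lemma norm2_mulmx_frobenius {R : realType} {n : nat} (M : 'M[R]_n)
    (v : 'cV[R]_n) :
  norm2 (M *m v) <= Num.sqrt (\sum_i \sum_j M i j ^+ 2) * norm2 v.
Proof.
have F0 : 0 <= \sum_i \sum_j M i j ^+ 2.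
  by apply: sumr_ge0 => i _; exact: sum_sqr_ge0.
rewrite -sqrtrM// ler_sqrt ?mulr_ge0 ?sum_sqr_ge0//.
rewrite mulr_suml; apply: ler_sum => i _.
by rewrite mxE; exact: cauchy_schwarz_sum.
Qed.

Lemma norm2_mulmx_le {R : realType} {n : nat} (M : 'M[R]_n) (v : 'cV[R]_n) :
  norm2 (M *m v) <= opnorm M * norm2 v.
Proof.
have le_opnorm u : norm2 u <= 1 -> norm2 (M *m u) <= opnorm M.
  move=> u1; apply: ub_le_sup; last by exists u.
  (* The Frobenius norm bounds the set, so its [sup] is a genuine upper bound. *)
  exists (Num.sqrt (\sum_i \sum_j M i j ^+ 2)) => _ [w w1 <-].
  apply: le_trans (norm2_mulmx_frobenius M w) _.
  by rewrite ler_piMr ?sqrtr_ge0.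
have [v0|v0] := eqVneq (norm2 v) 0.
  (* A vector of norm zero cannot be normalized; the Frobenius bound shows that its image has norm
     zero too. *)
  by have := norm2_mulmx_frobenius M v; rewrite v0 !mulr0.
have v_gt0 : 0 < norm2 v by rewrite lt_neqAle eq_sym v0 norm2_ge0.
have := le_opnorm ((norm2 v)^-1 *: v).
rewrite -scalemxAr !norm2Z ger0_norm ?invr_ge0 ?norm2_ge0//.
rewrite mulVf// => /(_ (lexx _)).
by rewrite mulrC ler_pdivrMr.
Qed.

Lemma opnorm_le {R : realType} {n : nat} (M : 'M[R]_n) (c : R) : 0 <= c ->
  (forall v, norm2 (M *m v) <= c * norm2 v) -> opnorm M <= c.
Proof.
move=> c0 Mc; apply: ge_sup => [|_ [v v1 <-]].
  exists (norm2 (M *m 0)), 0 => //=.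
  by rewrite -(scale0r 0) norm2Z normr0 mul0r ler01.
by apply: le_trans (Mc v) _; rewrite ler_piMr.
Qed.

Lemma opnorm_ge0 {R : realType} {n : nat} (M : 'M[R]_n.+1) : 0 <= opnorm M.
Proof.
have := norm2_mulmx_le M (delta_mx ord0 ord0).
by rewrite norm2_delta mulr1; apply: le_trans; exact: norm2_ge0.
Qed.

Lemma opnormM_le {R : realType} {n : nat} (M P : 'M[R]_n.+1) :
  opnorm (M *m P) <= opnorm M * opnorm P.
Proof.
apply: opnorm_le => [|v]; first by rewrite mulr_ge0 ?opnorm_ge0.
rewrite -mulmxA -mulrA; apply: le_trans (norm2_mulmx_le _ _) _.
by rewrite ler_wpM2l ?opnorm_ge0 ?norm2_mulmx_le.
Qed.

Lemma opnormZ_ge {R : realType} {n : nat} (a : R) (M : 'M[R]_n.+1) :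
  0 <= a -> a * opnorm M <= opnorm (a *: M).
Proof.
rewrite le_eqVlt => /predU1P[<-|a0]; first by rewrite mul0r opnorm_ge0.
rewrite mulrC -ler_pdivlMr//; apply: opnorm_le => [|v].
  by rewrite divr_ge0 ?opnorm_ge0 ?ltW.
rewrite mulrAC ler_pdivlMr// mulrC -{1}(gtr0_norm a0) -norm2Z scalemxAl.
exact: norm2_mulmx_le.
Qed.

(** Taking absolute values of the entries of [v] keeps its norm, and the triangle inequality bounds
    each entry of [M v] by that of [P |v|]. *)
Lemma opnorm_le_entrywise {R : realType} {n : nat} (M P : 'M[R]_n.+1) :
  (forall i j, 0 <= M i j <= P i j) -> opnorm M <= opnorm P.
Proof.
move=> MP; apply: opnorm_le => [|v]; first exact: opnorm_ge0.
pose w : 'cV[R]_n.+1 := \col_i `|v i ord0|.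
have -> : norm2 v = norm2 w.
  congr Num.sqrt; apply: eq_bigr => i _.
  by rewrite mxE real_normK ?num_real.
apply: le_trans (norm2_mulmx_le P w); apply: norm2_le => i.
rewrite !mxE; apply: le_trans (ler_norm_sum _ _ _) _; apply: ler_sum => j _.
have /andP[M0 leMP] := MP i j.
by rewrite mxE normrM ger0_norm// ler_wpM2r.
Qed.

(** For [w = M^T v], Cauchy-Schwarz gives [|w|^2 = <v, M w> <= |v| |M| |w|], and [|w|] cancels. *)
Lemma opnorm_tr_le {R : realType} {n : nat} (M : 'M[R]_n.+1) :
  opnorm M^T <= opnorm M.
Proof.
apply: opnorm_le => [|v]; first exact: opnorm_ge0.
set w := M^T *m v.
have [->|w0] := eqVneq (norm2 w) 0.
  by rewrite mulr_ge0 ?opnorm_ge0 ?norm2_ge0.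
have w_gt0 : 0 < norm2 w by rewrite lt_neqAle eq_sym w0 norm2_ge0.
rewrite -(ler_pM2r w_gt0) -expr2.
have -> : norm2 w ^+ 2 = (v^T *m (M *m w)) ord0 ord0.
  rewrite sqr_norm2 mulmxA -[v^T *m M]trmxK trmx_mul trmxK mxE.
  by apply: eq_bigr => i _; rewrite expr2 [_^T _ _]mxE.
apply: le_trans (dot_le_norm2 _ _) _.
by rewrite [opnorm M * _]mulrC -mulrA ler_wpM2l ?norm2_ge0 ?norm2_mulmx_le.
Qed.

Lemma norm2_col_le_opnorm {R : realType} {n : nat} (M : 'M[R]_n) (k : 'I_n) :
  norm2 (col k M) <= opnorm M.
Proof.
by have := norm2_mulmx_le M (delta_mx k ord0); rewrite norm2_delta mulr1 colE.
Qed.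

(** * Fusion coefficients: associativity, duality, reciprocity *)

Lemma fbasis_nat_inj {A : pzRingType} {m : nat} (F : fusion_ring A m)
    (f g : 'I_m.+1 -> nat) :
  \sum_l fbasis F l *+ f l = \sum_l fbasis F l *+ g l -> f =1 g.
Proof.
move=> fg l.
have [c [_ uniq_c]] := fbasis_free F (\sum_l fbasis F l *+ f l).
have cf : c = [ffun l => (f l)%:Z].
  by apply: uniq_c; apply: eq_bigr => i _; rewrite ffunE.
have cg : c = [ffun l => (g l)%:Z].
  by apply: uniq_c; rewrite fg; apply: eq_bigr => i _; rewrite ffunE.
by have /ffunP/(_ l) := etrans (esym cf) cg; rewrite !ffunE => -[].
Qed.

(** Compares the coefficients of [x_p] in the two bracketings of [x_j x_k x_l]. *)
Lemma fcoefA {A : pzRingType} {m : nat} (F : fusion_ring A m)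
    (j k l p : 'I_m.+1) :
  (\sum_s fcoef F j k s * fcoef F s l p =
   \sum_s fcoef F k l s * fcoef F j s p)%N.
Proof.
pose f p := (\sum_s fcoef F j k s * fcoef F s l p)%N.
pose g p := (\sum_s fcoef F k l s * fcoef F j s p)%N.
suff fg : f =1 g by exact: fg.
apply: (fbasis_nat_inj F); rewrite {}/f {}/g.
have expand (f : 'I_m.+1 -> nat) (g : 'I_m.+1 -> 'I_m.+1 -> nat) :
    \sum_p fbasis F p *+ (\sum_s f s * g s p) =
    \sum_s (\sum_p fbasis F p *+ g s p) *+ f s.
  under eq_bigr do rewrite -sumrMnr.
  rewrite exchange_big /=; apply: eq_bigr => s _.
  by rewrite -sumrMnl; apply: eq_bigr => q _; rewrite mulnC mulrnA.
have := mulrA (fbasis F j) (fbasis F k) (fbasis F l).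
rewrite !fbasisM mulr_sumr mulr_suml => jkl.
rewrite !expand.
under eq_bigr do rewrite -fbasisM -mulrnAl.
by rewrite -jkl; apply: eq_bigr => s _; rewrite -fbasisM mulrnAr.
Qed.

(* Both sides are the coefficient of 1 in x_j x_k x_l. *)
Lemma fcoef_rot {A : pzRingType} {m : nat} (F : fusion_ring A m)
    (j k l : 'I_m.+1) :
  fcoef F j k (fdual F l) = fcoef F k l (fdual F j).
Proof.
have := fcoefA F j k l ord0.
rewrite (bigD1 (fdual F l))//= big1 ?addn0 => [|s /negPf sl]; last first.
  by rewrite fcoef_unit sl muln0.
rewrite (bigD1 (fdual F j))//= big1 ?addn0 => [|s sj]; last first.
  rewrite fcoef_unit (_ : _ == _ = false) ?muln0//.
  by apply: contraNF sj => /eqP ->; rewrite fdualK.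
by rewrite !fcoef_unit fdualK !eqxx !muln1.
Qed.

(** Apply the anti-involution to [x_j x_k] and compare coordinates. *)
Lemma fcoef_dual {A : pzRingType} {m : nat} (F : fusion_ring A m)
    (j k l : 'I_m.+1) :
  fcoef F j k l = fcoef F (fdual F k) (fdual F j) (fdual F l).
Proof.
pose f l := fcoef F (fdual F k) (fdual F j) (fdual F l).
suff jk_f : fcoef F j k =1 f by exact: jk_f.
apply: (fbasis_nat_inj F); rewrite {}/f.
rewrite -fbasisM -[LHS](fstarK F) fstarM !fstar_basis fbasisM raddf_sum /=.
rewrite (reindex_inj (inv_inj (fdualK F))) /=.
by apply: eq_bigr => q _; rewrite raddfMn /= fstar_basis fdualK.
Qed.

(** Rotation gives [N_{j,k}^l = N_{k,l^*}^{j^*}], and duality turns this into [N_{l,k^*}^j]. *)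
Lemma fcoef_frobr {A : pzRingType} {m : nat} (F : fusion_ring A m)
    (j k l : 'I_m.+1) : fcoef F j k l = fcoef F l (fdual F k) j.
Proof.
by rewrite -[l in LHS](fdualK F) fcoef_rot fcoef_dual !fdualK.
Qed.

(** Mirror image of [fcoef_frobr]: dualize before and after it. *)
Lemma fcoef_frobl {A : pzRingType} {m : nat} (F : fusion_ring A m)
    (j k l : 'I_m.+1) : fcoef F j k l = fcoef F (fdual F j) l k.
Proof. by rewrite fcoef_dual fcoef_frobr fcoef_dual !fdualK. Qed.

Lemma fcoef1r {A : pzRingType} {m : nat} (F : fusion_ring A m)
    (j : 'I_m.+1) : fcoef F j ord0 j = 1%N.
Proof.
by rewrite fcoef_frobl fcoef_unit eqxx.
Qed.

(** * Multiplication matrices and Frobenius-Perron dimension *)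

Lemma fmx_dual {R : realType} {A : pzRingType} {m : nat}
    (F : fusion_ring A m) (j : 'I_m.+1) : fmx R F (fdual F j) = (fmx R F j)^T.
Proof. by apply/matrixP => k s; rewrite !mxE (fcoef_frobl F j). Qed.

(** Entry [(a, b)] of either side is the coefficient of [x_b] in [x_j x_k x_a]. The factors appear
    reversed because rows of [fmx] index the multiplied element. *)
Lemma fmxM {R : realType} {A : pzRingType} {m : nat} (F : fusion_ring A m)
    (j k : 'I_m.+1) :
  fmx R F k *m fmx R F j = \sum_l (fcoef F j k l)%:R *: fmx R F l.
Proof.
apply/matrixP => a b; rewrite mxE summxE.
transitivity ((\sum_s fcoef F k a s * fcoef F j s b)%N%:R : R).
  by rewrite natr_sum; apply: eq_bigr => s _; rewrite !mxE natrM.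
rewrite -fcoefA natr_sum; apply: eq_bigr => s _.
by rewrite !mxE natrM.
Qed.

Lemma fpdim_ge0 {R : realType} {A : pzRingType} {m : nat}
    (F : fusion_ring A m) (j : 'I_m.+1) : 0 <= fpdim R F j.
Proof. exact: opnorm_ge0. Qed.

Lemma fpdim_dual {R : realType} {A : pzRingType} {m : nat}
    (F : fusion_ring A m) (j : 'I_m.+1) : fpdim R F (fdual F j) = fpdim R F j.
Proof.
apply/le_anti; rewrite /fpdim fmx_dual opnorm_tr_le /=.
by rewrite -{1}[fmx R F j]trmxK opnorm_tr_le.
Qed.

(* As [N M_l <= M_k M_j] entrywise, this needs only [d] submultiplicative; it
   replaces multiplicativity of [d], which would require the
   Perron-Frobenius theorem. *)
Lemma fcoef_mul_fpdim_le {R : realType} {A : pzRingType} {m : nat}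
    (F : fusion_ring A m) (j k l : 'I_m.+1) :
  (fcoef F j k l)%:R * fpdim R F l <= fpdim R F j * fpdim R F k.
Proof.
rewrite [leRHS]mulrC; apply: le_trans (opnormM_le _ _).
apply: le_trans (opnormZ_ge _ _ (ler0n _ _)) _.
apply: opnorm_le_entrywise => a b; rewrite fmxM summxE (bigD1 l)//=.
rewrite lerDl !mxE mulr_ge0 ?ler0n//=.
by apply: sumr_ge0 => s _; rewrite !mxE mulr_ge0 ?ler0n.
Qed.

(** * Bounds on fusion coefficients *)

Lemma sum_sqr_fcoef_le_l {R : realType} {A : pzRingType} {m : nat}
    (F : fusion_ring A m) (j k : 'I_m.+1) :
  \sum_l ((fcoef F j k l)%:R : R) ^+ 2 <= fpdim R F j ^+ 2.
Proof.
rewrite -fpdim_dual; have := norm2_col_le_opnorm (fmx R F (fdual F j)) k.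
rewrite -(ler_pXn2r (ltn0Sn 1)) ?nnegrE ?norm2_ge0 ?opnorm_ge0// sqr_norm2.
by under eq_bigr do rewrite !mxE -fcoef_frobl.
Qed.

(** Duality exchanges the two factors, reducing this to the left bound for [x_{k^*} x_{j^*}]. *)
Lemma sum_sqr_fcoef_le_r {R : realType} {A : pzRingType} {m : nat}
    (F : fusion_ring A m) (j k : 'I_m.+1) :
  \sum_l ((fcoef F j k l)%:R : R) ^+ 2 <= fpdim R F k ^+ 2.
Proof.
rewrite -fpdim_dual; apply: le_trans (sum_sqr_fcoef_le_l _ _ (fdual F j)).
rewrite (reindex_inj (inv_inj (fdualK F))) /=.
by under eq_bigr do rewrite fcoef_dual fdualK.
Qed.

Lemma fcoef_le_l {R : realType} {A : pzRingType} {m : nat}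
    (F : fusion_ring A m) (j k l : 'I_m.+1) :
  (fcoef F j k l)%:R <= fpdim R F j.
Proof.
rewrite -(ler_pXn2r (ltn0Sn 1)) ?nnegrE ?ler0n ?fpdim_ge0//.
apply: le_trans (sum_sqr_fcoef_le_l F j k).
by rewrite (bigD1 l)//= lerDl; apply: sumr_ge0 => s _; exact: sqr_ge0.
Qed.

(** Supplies the positivity needed for quotients and real powers of dimensions. *)
Lemma fpdim_ge1 {R : realType} {A : pzRingType} {m : nat}
    (F : fusion_ring A m) (j : 'I_m.+1) : 1 <= fpdim R F j.
Proof. by have := @fcoef_le_l R _ _ F j ord0 j; rewrite fcoef1r. Qed.

(** Cauchy-Schwarz; keeping both minima covers every choice of one index from each product. *)
Lemma sum_fcoef_mul_le {R : realType} {A : pzRingType} {m : nat}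
    (F : fusion_ring A m) (j k p q : 'I_m.+1) :
  \sum_s ((fcoef F j k s)%:R : R) * (fcoef F p q s)%:R <=
  Num.min (fpdim R F j) (fpdim R F k) * Num.min (fpdim R F p) (fpdim R F q).
Proof.
have d0 := @fpdim_ge0 R _ _ F.
have min0 a b : 0 <= Num.min (fpdim R F a) (fpdim R F b) by rewrite le_min !d0.
have sum_le a b : \sum_s ((fcoef F a b s)%:R : R) ^+ 2 <=
    Num.min (fpdim R F a) (fpdim R F b) ^+ 2.
  by rewrite /Num.min; case: ifP => _;
    [exact: sum_sqr_fcoef_le_l | exact: sum_sqr_fcoef_le_r].
rewrite -(ler_pXn2r (ltn0Sn 1)) ?nnegrE ?mulr_ge0//; last first.
  by apply: sumr_ge0 => s _; rewrite mulr_ge0 ?ler0n.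
apply: le_trans (cauchy_schwarz_sum _ _) _.
by rewrite exprMn ler_pM ?sum_sqr_ge0.
Qed.

(* Both sides are the coefficient of 1 in [x_j x_k x_q^* x_p^*]. *)
Lemma sum_fcoef_rot {A : pzRingType} {m : nat} (F : fusion_ring A m)
    (j k p q : 'I_m.+1) :
  (\sum_s fcoef F j k s * fcoef F p q s =
   \sum_s fcoef F k (fdual F q) s * fcoef F (fdual F j) p s)%N.
Proof.
transitivity (\sum_s fcoef F j k s * fcoef F s (fdual F q) p)%N.
  by apply: eq_bigr => s _; rewrite (fcoef_frobr F p).
by rewrite fcoefA; apply: eq_bigr => s _; rewrite (fcoef_frobl F j s).
Qed.

(** The right side is [(x / y) ^ r], monotone in [r], so on [[-1, 1]] it is least at an endpoint,
    where it is [x / y] or [y / x]. *)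
Lemma min_ratio_le_powR {R : realType} (x y r : R) : 0 < x -> 0 < y ->
  -1 <= r <= 1 -> Num.min (x / y) (y / x) <= x `^ r * y `^ (- r).
Proof.
move=> x0 y0 /andP[r_ge r_le].
have xy0 : 0 < x / y by rewrite divr_gt0.
have -> : x `^ r * y `^ (- r) = (x / y) `^ r.
  by rewrite powRM ?invr_ge0 ?ltW// -[y^-1]powR_inv1 ?ltW// -powRrM mulN1r.
rewrite ge_min; apply/orP.
have [xy1|xy1] := leP (x / y) 1; [left|right].
  rewrite -{1}[x / y]powRr1 ?(ltW xy0)//.
  by apply: ger_powR => //; rewrite xy0.
have -> : y / x = (x / y) `^ (- 1) by rewrite powR_inv1 ?ltW// invf_div.
by rewrite ler_powR// ltW.
Qed.

Theorem proposition8p1 (R : realType) (A : pzRingType) (m : nat)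
    (F : fusion_ring A m) :
  let N := fcoef F in
  let d := fpdim R F in
  [/\ forall j k : 'I_m.+1,
        \sum_l ((N j k l)%:R : R) ^+ 2 <= Num.min (d j ^+ 2) (d k ^+ 2),
      forall (j k l : 'I_m.+1) (t : R), 1 <= t ->
        (N j k l)%:R <= d l * d j `^ ((2 - t) / t) * d k `^ ((t - 2) / t),
      forall j k l : 'I_m.+1,
        (N j k l)%:R <= Num.min (d j) (Num.min (d k) (d l))
    & forall j1 j2 j3 j4 : 'I_m.+1,
        \sum_s ((N j1 j2 s)%:R : R) * (N j3 j4 s)%:R <=
        Num.min (d j1 * d j2) (Num.min (d j1 * d j3)
          (Num.min (d j1 * d j4) (Num.min (d j2 * d j3)
            (Num.min (d j2 * d j4) (d j3 * d j4)))))].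
Proof.
move=> N d.
have d_gt0 j : 0 < d j by apply: lt_le_trans (fpdim_ge1 F j).
have d_dual j : d (fdual F j) = d j := fpdim_dual F j.
split=> [j k|j k l t t1|j k l|j1 j2 j3 j4].
- by rewrite le_min sum_sqr_fcoef_le_l sum_sqr_fcoef_le_r.
- have rE : (t - 2) / t = - ((2 - t) / t) by rewrite -mulNr opprB.
  have t_gt0 : 0 < t by apply: lt_le_trans t1.
  have r1 : -1 <= (2 - t) / t <= 1.
    by rewrite ler_pdivlMr// ler_pdivrMr//; apply/andP; split; lra.
  rewrite rE -mulrA.
  apply: le_trans (_ : d l * Num.min (d j / d k) (d k / d j) <= _).
    (* The first case uses the form [N_{j^*,l}^k], the second [N_{l,k^*}^j]. *)
    have [_|_] := leP (d j / d k).
      rewrite mulrA ler_pdivlMr// /N fcoef_frobl [leRHS]mulrC -(d_dual j).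
      exact: fcoef_mul_fpdim_le.
    rewrite mulrA ler_pdivlMr// /N fcoef_frobr -(d_dual k).
    exact: fcoef_mul_fpdim_le.
  by rewrite ler_pM2l// min_ratio_le_powR.
- rewrite !le_min fcoef_le_l /N fcoef_dual -(d_dual k) fcoef_le_l.
  by rewrite -fcoef_dual fcoef_frobr fcoef_le_l.
- have min_ge0 a b : 0 <= Num.min (d a) (d b) by rewrite le_min !fpdim_ge0.
  have le1 := @sum_fcoef_mul_le R _ _ F j1 j2 j3 j4.
  (* [le1] misses the pairs [j1, j2] and [j3, j4]; rotation regroups the indices as [j2, j4] and
     [j1, j3], which separates both. *)
  have le2 : \sum_s ((N j1 j2 s)%:R : R) * (N j3 j4 s)%:R <=
      Num.min (d j2) (d j4) * Num.min (d j1) (d j3).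
    have := @sum_fcoef_mul_le R _ _ F j2 (fdual F j4) (fdual F j1) j3.
    rewrite !fpdim_dual; apply: le_trans.
    under eq_bigr do rewrite -natrM.
    under [leRHS]eq_bigr do rewrite -natrM.
    by rewrite -!natr_sum /N (sum_fcoef_rot F j1).
  rewrite !le_min [d j1 * d j2]mulrC [d j3 * d j4]mulrC.
  apply/and5P; split; last (apply/andP; split).
  1,6: by apply: le_trans le2 _; rewrite ler_pM// ge_min lexx ?orbT.
  all: by apply: le_trans le1 _; rewrite ler_pM// ge_min lexx ?orbT.
Qed.
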